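(* Let $E \subset [0,1]^3$ and suppose that $\dim_{\mathcal H}(E) > \frac{13}{5}$. Then $$\dim_{\mathcal H}(E) + \dim_{\mathcal H}(\Lambda(E)) > 4.$$
   Context: $\dim_{\mathcal H}$ denotes Hausdorff dimension. For $E \subset \mathbb{R}^3$, $\Lambda(E) = \{ *(x^1 \wedge x^2) : x^1, x^2 \in E\} \subset \mathbb{R}^3$, where $* : \Lambda^2 \mathbb{R}^3 \to \mathbb{R}^3$ is the Hodge star operator; that is, $\Lambda(E)$ is the set of cross products $x^1 \times x^2$ with $x^1,x^2 \in E$. *)

(* Defs.v *)
From mathcomp Require Import all_boot all_order all_algebra.
From mathcomp Require Import all_classical all_reals all_analysis.

Set Implicit Arguments.
Unset Strict Implicit.
Unset Printing Implicit Defensive.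

Import Order.TTheory GRing.Theory Num.Theory.

Local Open Scope classical_set_scope.
Local Open Scope ring_scope.

(* The library's norm on 'rV[R]_n is the sup norm, hence this definition. *)
Definition eucl_norm (R : realType) (n : nat) (u : 'rV[R]_n) : R :=
  Num.sqrt (\sum_(i < n) u 0 i ^+ 2).

(* diam set0 = -oo *)
Definition diam (R : realType) (n : nat) (A : set 'rV[R]_n) : \bar R :=
  ereal_sup [set (eucl_norm (p.1 - p.2))%:E | p in A `*` A].

(* diam(A)^s, with the usual conventions for s = 0: the empty set has gauge 0,
   and a singleton has gauge 0 `^ 0 = 1, so that H^0 is the counting measure. *)
Definition diam_pow (R : realType) (n : nat) (s : R) (A : set 'rV[R]_n) :
    \bar R :=
  if A == set0 then 0%E else poweR (diam A) s.

Definition hausdorff_premeasure (R : realType) (n : nat) (s delta : R)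
    (A : set 'rV[R]_n) : \bar R :=
  ereal_inf [set (\sum_(0 <= k <oo) diam_pow s (U k))%E |
    U in [set U : nat -> set 'rV[R]_n |
           A `<=` \bigcup_k U k /\ forall k, (diam (U k) <= delta%:E)%E]].

(* The premeasure is nonincreasing in delta, so the supremum over delta > 0 is
   the limit as delta tends to 0. *)
Definition hausdorff_measure (R : realType) (n : nat) (s : R)
    (A : set 'rV[R]_n) : \bar R :=
  ereal_sup [set hausdorff_premeasure s delta A |
    delta in [set delta : R | 0 < delta]].

Definition hausdorff_dim (R : realType) (n : nat) (A : set 'rV[R]_n) :
    \bar R :=
  ereal_inf [set s%:E |
    s in [set s : R | 0 <= s /\ hausdorff_measure s A = 0%E]].

(* Indices live in 'I_3 = Z/3, so j + 1 and j + 2 are taken mod 3. *)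
Definition cross_product (R : realType) (u v : 'rV[R]_3) : 'rV[R]_3 :=
  \row_(j < 3) (u 0 (j + 1) * v 0 (j + 2) - u 0 (j + 2) * v 0 (j + 1)).

(* In dimension 3, the Hodge star of x1 /\ x2 is the cross product x1 x x2. *)
Definition Lambda (R : realType) (E : set 'rV[R]_3) : set 'rV[R]_3 :=
  [set cross_product p.1 p.2 | p in E `*` E].

(* Main.v *)
Require Import Defs.
From mathcomp Require Import all_boot all_order all_algebra.
From mathcomp Require Import all_classical all_reals all_analysis.
From mathcomp Require Import ring lra.

Set Implicit Arguments.
Unset Strict Implicit.
Unset Printing Implicit Defensive.

Import Order.TTheory GRing.Theory Num.Theory.

Local Open Scope classical_set_scope.
Local Open Scope ring_scope.

(** Fix a nonzero point [a] of [E]. The set [Lambda E] contains all cross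
    products [a x y] with [y] in [E], and [y |-> a x y] is, up to rotation and
    scaling, the orthogonal projection to the plane orthogonal to [a]. The
    fibres of a projection onto a plane are lines, so it lowers the Hausdorff
    dimension by at most 1: [dim E <= dim (Lambda E) + 1]. Therefore
    [dim E + dim (Lambda E) >= 2 dim E - 1 > 26/5 - 1 = 21/5 > 4].

    The bound on the drop of dimension is [hausdorff_dim_fibre], proved by
    pulling back an efficient cover of the image and slicing the resulting
    tubes; [cross_product_expand] shows that it applies to [y |-> a x y], with
    a coordinate [i] such that [a 0 i != 0] parametrizing the fibres. *)

(** * Euclidean norm and diameter *)

Lemma ler_norm_eucl_norm (R : realType) n (u : 'rV[R]_n) i :
  `|u 0 i| <= eucl_norm u.
Proof.
rewrite -sqrtr_sqr ler_wsqrtr// (bigD1 i)//= lerDl.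
by apply: sumr_ge0 => j _; exact: sqr_ge0.
Qed.

Lemma ler_eucl_norm_sum (R : realType) n (u : 'rV[R]_n) :
  eucl_norm u <= \sum_(i < n) `|u 0 i|.
Proof.
have S0 (I : seq 'I_n) : 0 <= \sum_(i <- I) `|u 0 i| by exact: sumr_ge0.
rewrite -[leRHS]ger0_norm// -sqrtr_sqr ler_wsqrtr//.
elim: (index_enum _) => [|i I IH]; first by rewrite !big_nil expr0n.
rewrite !big_cons sqrrD real_normK ?num_real// -addrA lerD2l.
by rewrite (le_trans IH)// lerDr mulrn_wge0// mulr_ge0.
Qed.

Lemma diam_leP (R : realType) n (A : set 'rV[R]_n) (r : R) :
  (diam A <= r%:E)%E <-> forall x y, A x -> A y -> eucl_norm (x - y) <= r.
Proof.
split=> [Ar x y Ax Ay|Ar].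
  rewrite -lee_fin; apply: le_trans Ar; apply: ereal_sup_ubound.
  by exists (x, y).
by apply: ge_ereal_sup => _ [[x y] [Ax Ay] <-]; rewrite lee_fin; exact: Ar.
Qed.

Lemma diam_ge0 (R : realType) n (A : set 'rV[R]_n) :
  A !=set0 -> (0 <= diam A)%E.
Proof.
move=> [x Ax]; apply: (@le_trans _ _ (eucl_norm (x - x))%:E).
  by rewrite lee_fin sqrtr_ge0.
by apply: ereal_sup_ubound; exists (x, x).
Qed.

Lemma diam_pow_ge0 (R : realType) n s (A : set 'rV[R]_n) :
  (0 <= diam_pow s A)%E.
Proof. by rewrite /diam_pow; case: ifP => // _; exact: poweR_ge0. Qed.

Lemma diam_pow_le (R : realType) n (s r : R) (A : set 'rV[R]_n) :
  0 <= s -> (diam A <= r%:E)%E -> (diam_pow s A <= (r `^ s)%:E)%E.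
Proof.
move=> s0 Ar; rewrite /diam_pow; case: eqVneq => [_|/set0P A0].
  by rewrite lee_fin powR_ge0.
have d0 := diam_ge0 A0.
rewrite -poweR_EFin; apply: gt0_ler_poweR => //.
- by rewrite in_itv/= d0 leey.
- by rewrite in_itv/= (le_trans d0 Ar) leey.
Qed.

(** * Null sets for Hausdorff measures in terms of covers *)

Lemma hausdorff_measure_eq0_cover (R : realType) n (s : R)
    (A : set 'rV[R]_n) (delta e : R) :
  hausdorff_measure s A = 0%E -> 0 < delta -> 0 < e ->
  exists U : nat -> set 'rV[R]_n,
    [/\ A `<=` \bigcup_k U k, forall k, (diam (U k) <= delta%:E)%E
      & (\sum_(0 <= k <oo) diam_pow s (U k) <= e%:E)%E].
Proof.
move=> HA delta0 e0.
have : (hausdorff_premeasure s delta A < e%:E)%E.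
  apply: (@le_lt_trans _ _ 0%E); last by rewrite lte_fin.
  by rewrite -HA; apply: ereal_sup_ubound; exists delta.
by move=> /ereal_inf_lt[_ [U [AU Ud] <-] /ltW Ue]; exists U.
Qed.

(** Covers come naturally as double sequences when each set of a given cover is
    subdivided; since [nat * nat] is countable and gauges are nonnegative, such
    a cover can be renumbered as a single sequence with the same sum. *)
Lemma hausdorff_measure_eq0 (R : realType) n (s : R) (A : set 'rV[R]_n) :
  (forall delta e : R, 0 < delta -> 0 < e ->
    exists V : nat -> nat -> set 'rV[R]_n,
    [/\ A `<=` \bigcup_k \bigcup_j V k j,
        forall k j, (diam (V k j) <= delta%:E)%E
      & (\sum_(0 <= k <oo) \sum_(0 <= j <oo) diam_pow s (V k j) <= e%:E)%E]) ->
  hausdorff_measure s A = 0%E.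
Proof.
move=> HA; apply/eqP; rewrite eq_le; apply/andP; split; last first.
  apply: (@le_trans _ _ (hausdorff_premeasure s 1 A)); last first.
    by apply: ereal_sup_ubound; exists 1 => //=.
  apply: le_ereal_inf_tmp => _ [U _ <-].
  by apply: nneseries_ge0 => k _ _; exact: diam_pow_ge0.
apply: ge_ereal_sup => _ [delta /= delta0 <-].
apply/lee_addgt0Pr => e e0; rewrite add0e.
have [V [AV Vd Ve]] := HA delta e delta0 e0.
have [h hbij] : exists h : nat -> nat * nat,
    set_bij [set: nat] [set: nat * nat] h.
  by apply/card_set_bijP; exact: card_esym card_nat2.
have dp0 k : (0 <= diam_pow s (V (h k).1 (h k).2))%E by exact: diam_pow_ge0.
apply: (@le_trans _ _ (\sum_(0 <= k <oo) diam_pow s (V (h k).1 (h k).2))%E).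
  apply: ereal_inf_lbound; exists (fun k => V (h k).1 (h k).2) => //.
  split => //.
  move=> x /AV[k _ [j _ Vx]]; have [_ _ hsurj] := hbij.
  by have [l _ hl] := hsurj (k, j) I; exists l => //=; rewrite hl.
apply: le_trans Ve; rewrite nneseries_esumT//.
rewrite -(reindex_esum _ _ h (fun p => diam_pow s (V p.1 p.2)) hbij).
rewrite nneseries_esumT; last first.
  by move=> k; apply: nneseries_ge0 => j _ _; exact: diam_pow_ge0.
rewrite (eq_esum (b := fun k => \esum_(j in [set: nat]) diam_pow s (V k j))%E).
  rewrite esum_esum; last by move=> k j _ _; exact: diam_pow_ge0.
  by rewrite (_ : _ `*`` _ = setT)//; apply/seteqP; split.
by move=> k _; apply: nneseries_esumT => j; exact: diam_pow_ge0.
Qed.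

Lemma sum_diam_pow_le (R : realType) n (s c : R) (N : nat)
    (V : nat -> set 'rV[R]_n) :
  (forall j, (diam_pow s (V j) <= c%:E)%E) ->
  (forall j, (N <= j)%N -> V j = set0) ->
  (\sum_(0 <= j <oo) diam_pow s (V j) <= (N%:R * c)%:E)%E.
Proof.
move=> Vc V0; rewrite (nneseries_split _ N); last first.
  by move=> k _; exact: diam_pow_ge0.
rewrite add0n [X in (_ + X)%E]eseries0 ?adde0; last first.
  by move=> j Nj _; rewrite V0// /diam_pow eqxx.
apply: (@le_trans _ _ (\sum_(0 <= k < N) c%:E)%E); first exact: lee_sum.
by rewrite sumEFin sumr_const_nat subn0 mulr_natl.
Qed.

(** Subdividing at the scale of [diam U] is impossible when [U] is a singleton
    or empty. Passing from the exponent [s] to a larger [t > s] leaves room to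
    replace [diam U] by a positive radius at the cost of an arbitrarily small
    error; this includes [s = 0], where a singleton has gauge 1. *)
Lemma diam_radius (R : realType) n (s t delta e : R) (U : set 'rV[R]_n) :
  0 <= s -> s < t -> 0 < delta <= 1 -> 0 < e -> (diam U <= delta%:E)%E ->
  exists rho : R, [/\ 0 < rho <= delta, (diam U <= rho%:E)%E
    & ((rho `^ t)%:E <= diam_pow s U + e%:E)%E].
Proof.
move=> s0 st /andP[d0 d1] e0 Ud.
have t0 : 0 < t by exact: le_lt_trans st.
(* The second term is the radius whose t-th power is e. *)
pose eta := Num.min delta (e `^ t^-1).
have eta0 : 0 < eta by rewrite lt_min d0 powR_gt0.
have etad : eta <= delta by rewrite ge_min lexx.
have etae : eta `^ t <= e.
  rewrite -[leRHS](powRr1 (ltW e0)) -(mulVf (lt0r_neq0 t0)) powRrM.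
  rewrite ge0_ler_powR ?nnegrE ?(ltW eta0) ?powR_ge0 ?(ltW t0)//.
  by rewrite ge_min lexx orbT.
rewrite /diam_pow; case: eqVneq => [U0|/set0P U0].
  exists eta; split; rewrite ?eta0//.
    by apply/diam_leP; rewrite U0.
  by rewrite add0e lee_fin.
have dge0 := diam_ge0 U0.
have [r Ur] : exists r, diam U = r%:E.
  by move: dge0 Ud; case: (diam U) => // r _ _; exists r.
rewrite Ur !lee_fin in dge0 Ud *.
exists (Num.max r eta); split.
- by rewrite lt_max eta0 orbT ge_max Ud etad.
- by rewrite lee_fin le_max lexx.
have rt : r `^ t <= r `^ s.
  move: dge0; rewrite le_eqVlt => /predU1P[<-|r0].
    by rewrite powR0 ?gt_eqF// powR_ge0.
  by rewrite ger_powR ?r0 ?(le_trans Ud)// ltW.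
rewrite -EFinD lee_fin maxEle; case: ifP => _.
  by rewrite (le_trans etae)// lerDr powR_ge0.
by rewrite (le_trans rt)// lerDl ltW.
Qed.

(** * Dimension of a set fibred over another one *)

(** A set [U] of diameter at most [rho] has as preimage in [A] a tube whose
    coordinate [g] runs through an interval of length 1. Cutting this interval
    into about [1 / rho] steps of length [rho] cuts the tube into pieces of
    diameter at most [C * rho], of total gauge at most a constant times
    [rho `^ (t + 1) / rho = rho `^ t]. *)
Lemma hausdorff_measure_fibre (R : realType) (n m : nat)
    (A : set 'rV[R]_n) (B : set 'rV[R]_m) (f : 'rV[R]_n -> 'rV[R]_m)
    (g : 'rV[R]_n -> R) (C s t : R) :
  0 < C -> (forall x, A x -> B (f x)) -> (forall x, A x -> 0 <= g x <= 1) ->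
  (forall x y rho, A x -> A y ->
    eucl_norm (f x - f y) <= rho -> `|g x - g y| <= rho ->
    eucl_norm (x - y) <= C * rho) ->
  0 <= s -> s < t ->
  hausdorff_measure s B = 0%E -> hausdorff_measure (t + 1) A = 0%E.
Proof.
move=> C0 fAB gA01 fg_expand s0 st HB.
apply: hausdorff_measure_eq0 => delta e delta0 e0.
have t0 : 0 < t by exact: le_lt_trans st.
(* The total gauge of the slices is at most K times that of the cover of B. *)
pose K := 2 * C `^ (t + 1).
have K0 : 0 < K by rewrite mulr_gt0 ?powR_gt0.
(* One half of e / K bounds the gauge of the cover of B, the other half the sum
   of the errors on its radii. *)
pose e1 := e / K / 2.
have e10 : 0 < e1 by rewrite !divr_gt0.
(* Pieces of diameter at most C * d1 fit below delta; the bound 1 is what makes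
   radii decrease when the exponent grows from s to t. *)
pose d1 := Num.min 1 (delta / C).
have d10 : 0 < d1 <= 1 by rewrite lt_min ltr01 divr_gt0//= ge_min lexx.
have [||U [BU Ud Ue]] := @hausdorff_measure_eq0_cover _ _ _ _ d1 e1 HB => //.
  by case/andP: d10.
have /choice[rho rhoP] : forall k, exists r : R,
    [/\ 0 < r <= d1, (diam (U k) <= r%:E)%E
      & ((r `^ t)%:E <= diam_pow s (U k) + (e1 / (2 ^ k.+1)%:R)%:E)%E].
  move=> k; apply: diam_radius => //.
  by rewrite divr_gt0// ltr0n expn_gt0.
(* The slice number j of the tube over U k; as g <= 1, it is empty as soon as
   j > 1 / rho k, so that each tube has finitely many slices. *)
pose V k j := [set x | [/\ A x, U k (f x) & Num.trunc (g x / rho k) = j]].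
have Vd k j : (diam (V k j) <= (C * rho k)%:E)%E.
  have [/andP[r0 _] /diam_leP Ur _] := rhoP k.
  apply/diam_leP => x y [Ax Ux xj] [Ay Uy yj].
  apply: fg_expand => //; first exact: Ur.
  have gr z : A z -> 0 <= g z / rho k.
    by move=> /gA01/andP[g0 _]; rewrite divr_ge0// ltW.
  have := truncn_itv (gr _ Ax); have := truncn_itv (gr _ Ay).
  rewrite xj yj -natr1 !ler_pdivlMr// !ltr_pdivrMr//.
  move=> /andP[y1 y2] /andP[x1 x2].
  by rewrite ler_norml; apply/andP; split; nra.
exists V; split.
- move=> x Ax; have [k _ Uk] := BU _ (fAB _ Ax).
  by exists k => //; exists (Num.trunc (g x / rho k)).
- move=> k j; apply: (le_trans (Vd k j)); rewrite lee_fin.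
  have [/andP[_ rd] _ _] := rhoP k.
  by rewrite mulrC -ler_pdivlMr// (le_trans rd)// ge_min lexx orbT.
have VK k : (\sum_(0 <= j <oo) diam_pow (t + 1) (V k j) <=
    K%:E * (diam_pow s (U k) + (e1 / (2 ^ k.+1)%:R)%:E))%E.
  have [/andP[r0 rd] _ rt] := rhoP k.
  have r1 : rho k <= 1 by apply: le_trans rd _; case/andP: d10.
  pose N := (Num.trunc (rho k)^-1).+1.
  apply: (@le_trans _ _ (N%:R * (C * rho k) `^ (t + 1))%:E).
    apply: sum_diam_pow_le => [j|j Nj].
      by apply: diam_pow_le (Vd k j); rewrite addr_ge0// ltW.
    apply/seteqP; split => // x [Ax _ xj].
    move: Nj; rewrite -xj ltnNge => /negP; apply.
    apply: le_truncn; rewrite -[leRHS]mul1r ler_wpM2r ?invr_ge0 ?(ltW r0)//.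
    by case/andP: (gA01 _ Ax).
  apply: le_trans (lee_wpmul2l _ rt); last by rewrite lee_fin ltW.
  rewrite -EFinM lee_fin powRM ?(ltW r0) ?(ltW C0)//.
  rewrite [rho k `^ _]powRD; last by rewrite (gt_eqF r0) implybT.
  rewrite powRr1 ?(ltW r0)//.
  (* There are at most 1 / rho + 1 <= 2 / rho slices, since rho <= 1. *)
  have Nr : N%:R * rho k <= 2.
    rewrite /N -natr1 mulrDl mul1r (_ : 2 = 1 + 1)// lerD//.
    rewrite -ler_pdivlMr// mul1r truncn_le invr_ge0; exact: ltW.
  rewrite /K (_ : N%:R * _ = (N%:R * rho k) * (C `^ (t + 1) * rho k `^ t)).
    by rewrite -[leRHS]mulrA ler_wpM2r// mulr_ge0// powR_ge0.
  by ring.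
apply: (@le_trans _ _
    (\sum_(0 <= k <oo) K%:E * (diam_pow s (U k) + (e1 / (2 ^ k.+1)%:R)%:E))%E).
  apply: lee_nneseries => // k _ _.
  by apply: nneseries_ge0 => j _ _; exact: diam_pow_ge0.
rewrite nneseriesZl; last first.
  by move=> k _; rewrite adde_ge0 ?diam_pow_ge0// lee_fin divr_ge0 ?(ltW e10).
apply: (@le_trans _ _ (K%:E * (e1%:E + e1%:E))%E).
  apply: lee_wpmul2l; first by rewrite lee_fin ltW.
  apply: le_trans (epsilon_trick xpredT _ (ltW e10)) _ => [k|].
    exact: diam_pow_ge0.
  exact: leeD.
by rewrite -EFinD -EFinM lee_fin /e1 -splitr mulrC divfK// gt_eqF.
Qed.

(** The hypotheses say that [(f, g)] embeds [A] into the product of [B] and the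
    segment [[0, 1]], with a Lipschitz inverse. A product with a segment exceeds
    the dimension of [B] by at most 1, because a segment can be covered
    efficiently by equal pieces at every scale: whatever radii occur in a cover
    of [B], the segment is cut at the same radii. *)
Lemma hausdorff_dim_fibre (R : realType) (n m : nat)
    (A : set 'rV[R]_n) (B : set 'rV[R]_m) (f : 'rV[R]_n -> 'rV[R]_m)
    (g : 'rV[R]_n -> R) (C : R) :
  0 < C -> (forall x, A x -> B (f x)) -> (forall x, A x -> 0 <= g x <= 1) ->
  (forall x y rho, A x -> A y ->
    eucl_norm (f x - f y) <= rho -> `|g x - g y| <= rho ->
    eucl_norm (x - y) <= C * rho) ->
  (hausdorff_dim A <= hausdorff_dim B + 1%:E)%E.
Proof.
move=> C0 fAB gA01 fg_expand.
rewrite -leeBlDr//; apply: le_ereal_inf_tmp => _ [s [s0 HB] <-].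
rewrite leeBlDr//; apply/lee_addgt0Pr => e e0.
apply: ereal_inf_lbound; exists (s + e + 1); last by rewrite !EFinD addeAC.
split; first by rewrite !addr_ge0// ltW.
by apply: hausdorff_measure_fibre fg_expand s0 _ HB; rewrite // ltrDl.
Qed.

Lemma hausdorff_dim_subset1 (R : realType) n (x : 'rV[R]_n) (A : set 'rV[R]_n) :
  A `<=` [set x] -> (hausdorff_dim A <= 1%:E)%E.
Proof.
move=> Ax; apply: ereal_inf_lbound; exists 1 => //; split => //.
have d0 : (diam A <= 0%:E)%E.
  apply/diam_leP => y z /Ax -> /Ax ->; rewrite subrr.
  rewrite /eucl_norm big1 ?sqrtr0// => i _; by rewrite mxE expr0n.
apply: hausdorff_measure_eq0 => delta e delta0 e0; exists (fun _ _ => A); split.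
- by move=> y Ay; exists 0%N => //; exists 0%N.
- by move=> k j; apply: le_trans d0 _; rewrite lee_fin ltW.
rewrite eseries0 ?lee_fin ?(ltW e0)// => k _ _; rewrite eseries0// => j _ _.
apply/eqP; rewrite eq_le diam_pow_ge0 andbT.
by apply: le_trans (diam_pow_le ler01 d0) _; rewrite powR0.
Qed.

(** * The cross product with a fixed vector *)

(** The linear map [w |-> a x w] has kernel the line spanned by [a], and the
    [i]-th coordinate does not vanish on that line when [a 0 i != 0]; hence the
    two together control [w]. Explicitly, two components of [a x w] read
    [+/- (a_i w_j - a_j w_i)] and bound the coordinates [w_j], [j != i]; all
    three coordinates are at most [2 * rho / `|a_i|], whence the constant 6. *)
Lemma cross_product_expand (R : realType) (a x y : 'rV[R]_3)
    (i : 'I_3) (rho : R) :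
  (forall j, `|a 0 j| <= 1) -> a 0 i != 0 ->
  eucl_norm (cross_product a x - cross_product a y) <= rho ->
  `|x 0 i - y 0 i| <= rho ->
  eucl_norm (x - y) <= 6 / `|a 0 i| * rho.
Proof.
move=> a1 ai0 axy xyi.
set w := x - y.
have axyE : cross_product a x - cross_product a y = cross_product a w.
  by apply/rowP => j; rewrite !mxE; ring.
have wi : `|w 0 i| <= rho by rewrite !mxE.
rewrite axyE in axy.
have cw j : `|cross_product a w 0 j| <= rho.
  exact: le_trans (ler_norm_eucl_norm _ _) axy.
have [i21 i22 i11 i12] : [/\ i + 2 + 1 = i, i + 2 + 2 = i + 1, i + 1 + 1 = i + 2
    & i + 1 + 2 = i].
  by case: (i) => [[|[|[|//]]] ?]; split; apply/val_inj.
have ai : 0 < `|a 0 i| by rewrite normr_gt0.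
have rho0 : 0 <= rho by exact: le_trans wi.
have key p q : `|p| <= 1 -> `|a 0 i * q - p * w 0 i| <= rho ->
    `|q| <= 2 * rho / `|a 0 i|.
  move=> p1 h; rewrite ler_pdivlMr// mulrC -normrM -[_ * q](subrK (p * w 0 i)).
  apply: le_trans (ler_normD _ _) _.
  rewrite (_ : 2 * rho = rho + rho); last by ring.
  apply: lerD => //; rewrite normrM -[leRHS]mul1r; exact: ler_pM.
have w1 : `|w 0 (i + 1)| <= 2 * rho / `|a 0 i|.
  by apply: (key (a 0 (i + 1))) => //; have := cw (i + 2); rewrite mxE i21 i22.
have w2 : `|w 0 (i + 2)| <= 2 * rho / `|a 0 i|.
  apply: (key (a 0 (i + 2))) => //; have := cw (i + 1).
  by rewrite mxE i11 i12 distrC.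
have w0 : `|w 0 i| <= 2 * rho / `|a 0 i|.
  rewrite ler_pdivlMr// (le_trans (y := rho * 1))//; first exact: ler_pM.
  by rewrite mulr1 mulr_natl mulr2n lerDl.
apply: le_trans (ler_eucl_norm_sum _) _.
apply: (@le_trans _ _ (\sum_(j < 3) 2 * rho / `|a 0 i|)).
  apply: ler_sum => j _.
  have : [|| j == i, j == i + 1 | j == i + 2].
    by case: (i) (j) => [[|[|[|//]]] ?] [[|[|[|//]]] ?].
  by case/or3P => /eqP ->.
rewrite sumr_const card_ord -[leLHS]mulr_natl.
rewrite (_ : 6 / _ * rho = 3 * (2 * rho / `|a 0 i|))//.
by ring.
Qed.

Theorem theorem1p3 (R : realType) (E : set 'rV[R]_3)
  (E_cube : E `<=` [set x : 'rV[R]_3 | forall i : 'I_3, 0 <= x 0 i <= 1])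
  (E_dim : ((13 / 5)%:E < hausdorff_dim E)%E) :
  (4%:E < hausdorff_dim E + hausdorff_dim (Lambda E))%E.
Proof.
have [a Ea a_neq0] : exists2 a, E a & a != 0.
  apply/not_exists2P => E0.
  have : (hausdorff_dim E <= 1%:E)%E.
    apply: (@hausdorff_dim_subset1 _ _ 0) => x Ex /=.
    by apply/eqP; case: (E0 x) => // /negP; rewrite negbK.
  by move=> /(lt_le_trans E_dim); rewrite lte_fin; lra.
have [i ai0] : exists i, a 0 i != 0.
  apply/not_existsP => a0; move/eqP: a_neq0; apply; apply/rowP => i.
  by rewrite mxE; apply/eqP/negPn/negP/a0.
have a1 j : `|a 0 j| <= 1.
  by have /andP[? ?] := E_cube _ Ea j; rewrite ger0_norm.
have dimE : (hausdorff_dim E <= hausdorff_dim (Lambda E) + 1%:E)%E.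
  apply: (@hausdorff_dim_fibre _ _ _ _ _ (cross_product a) (fun x => x 0 i)
    (6 / `|a 0 i|)).
  - by rewrite divr_gt0// normr_gt0.
  - by move=> x Ex; exists (a, x).
  - by move=> x Ex; exact: E_cube.
  - by move=> x y rho _ _; exact: cross_product_expand.
case: (hausdorff_dim E) E_dim dimE => [u||]//;
  case: (hausdorff_dim (Lambda E)) => [v||]//=.
- by rewrite -!EFinD !lee_fin !lte_fin; lra.
- by rewrite addey// ltry.
- by move=> _ _; exact: ltry.
Qed.
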